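(* Suppose there exist a constant $\widetilde\theta$ and a function $\widetilde V:\mathbb{R}^{S}\to\mathbb{R}$ solving the reduced-state Bellman optimality equation $$\widetilde\theta+\widetilde V(\mathbf{x}_k)=\mathbb{E}_{\{\mathbf{H}_k,\delta_k\}}\Big[\min_{\mathbf{u}_k}\big[r(\mathbf{S}_k,\mathbf{u}_k)+\mathbb{E}[\widetilde V(\mathbf{x}_{k+1})\mid \mathbf{S}_k,\mathbf{u}_k]\big]\Big],\qquad \forall\,\mathbf{x}_k\in\mathbb{R}^{S},$$ where $\mathbf{S}_k=(\mathbf{x}_k,\mathbf{H}_k,\delta_k)$. Then: (1) $\widetilde\theta=\theta=\min_{\pi}\limsup_{K\to\infty}\frac1K\sum_{k=0}^{K}\mathbb{E}[r(\mathbf{S}_k,\mathbf{u}_k)]$ is the optimal average cost of the optimal control problem; (2) $\widetilde V(\mathbf{x}_k)=\mathbb{E}[V(\mathbf{S}_k)\mid\mathbf{x}_k]$ is the optimal reduced state value function, where $V$ is the optimal value function of the extended state; (3) the optimal control policy of the problem is given by the $\mathbf{u}_k^*$ (as a function of $\mathbf{S}_k$) that attains the minimum on the right-hand side of the reduced-state Bellman optimality equation.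
   Context: Plant: $\mathbf{x}_{k+1}=\mathbf{A}\mathbf{x}_k+\mathbf{B}\widetilde{\mathbf{u}}_k+\mathbf{w}_k$, $k\ge0$, with $\mathbf{x}_k\in\mathbb{R}^{S}$, $\mathbf{A}\in\mathbb{R}^{S\times S}$, $\mathbf{B}\in\mathbb{R}^{S\times N_r}$, and $\mathbf{w}_k$ zero-mean noise with finite covariance matrix $\mathbf{W}$. The received control signal is $\widetilde{\mathbf{u}}_k=\delta_k\mathbf{H}_k\mathbf{u}_k+\mathbf{v}_k$, where $\mathbf{u}_k\in\mathbb{R}^{N_t}$ is the control action, $\mathbf{H}_k\in\mathbb{R}^{N_r\times N_t}$ is i.i.d. over $k$ with i.i.d. $\mathcal N(0,1)$ entries, $\delta_k\in\{0,1\}$ is i.i.d. over $k$, and $\mathbf{v}_k\sim\mathcal N(0,\mathbf{I}_{N_r})$. Thus $\mathbf{x}_{k+1}=\mathbf{A}\mathbf{x}_k+\delta_k\mathbf{B}\mathbf{H}_k\mathbf{u}_k+\mathbf{B}\mathbf{v}_k+\mathbf{w}_k$. The processes $\{\mathbf{H}_k\},\{\delta_k\},\{\mathbf{v}_k\},\{\mathbf{w}_k\}$ are mutually independent and i.i.d. over $k$. Extended state: $\mathbf{S}_k=(\mathbf{x}_k,\mathbf{H}_k,\delta_k)$. A control policy $\pi=\{\Omega^0,\Omega^1,\dots\}$ is a sequence of mappings with $\mathbf{u}_k=\Omega^k(\mathbf{S}_k)$. Per-stage cost: $r(\mathbf{S}_k,\mathbf{u}_k)=\mathbf{x}_k^T\mathbf{Q}\mathbf{x}_k+\mathbf{u}_k^T\mathbf{R}\mathbf{u}_k+\mathbb{E}[\widetilde{\mathbf{u}}_k^T\mathbf{M}\widetilde{\mathbf{u}}_k\mid\mathbf{S}_k]$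 (for the given action $\mathbf u_k$), with positive definite $\mathbf{Q}\in\mathbb{R}^{S\times S}$, $\mathbf{R}\in\mathbb{R}^{N_t\times N_t}$, $\mathbf{M}\in\mathbb{R}^{N_r\times N_r}$. Optimal control problem: minimize over $\pi$ the cost $\mathcal J^\pi=\limsup_{K\to\infty}\frac1K\sum_{k=0}^{K}\mathbb{E}[r(\mathbf{S}_k,\mathbf{u}_k)]$ subject to the dynamics $\mathbf{x}_{k+1}=\mathbf{A}\mathbf{x}_k+\delta_k\mathbf{B}\mathbf{H}_k\mathbf{u}_k+\mathbf{B}\mathbf{v}_k+\mathbf{w}_k$, $k\ge0$. Optimal value function: the function $V$ which, together with the constant $\theta$, satisfies the Bellman optimality equation $\theta+V(\mathbf{S}_k)=\min_{\mathbf{u}_k}\big[r(\mathbf{S}_k,\mathbf{u}_k)+\mathbb{E}[V(\mathbf{S}_{k+1})\mid\mathbf{S}_k,\mathbf{u}_k]\big]$ for all $\mathbf{S}_k$.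
   Formalization: Added: Ṽ is Borel, bounded below, has E Ṽ(x_0) < ∞ and liminf E[Ṽ(x_K)]/K ≤ 0 under every finite-cost policy; minima are attained measurably; θ unique and V exists in this class. Otherwise false: A=2, Q=1, δ=0, Ṽ=−x²/3. *)

(* Defs.v *)
From HB Require Import structures.
From mathcomp Require Import all_boot all_order all_algebra.
From mathcomp Require Import all_classical all_reals all_analysis.

Set Implicit Arguments.
Unset Strict Implicit.
Unset Printing Implicit Defensive.

Import Order.TTheory GRing.Theory Num.Theory.
Import numFieldNormedType.Exports.

Local Open Scope classical_set_scope.
Local Open Scope ring_scope.

Section measurable_matrix.
Variables (R : realType) (m n : nat).

(* Borel sigma-algebra of R^(m x n), as the one generated by the entries. *)
Definition mx_sigma : set (set 'M[R]_(m, n)) :=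
  <<s \bigcup_(ij in [set: 'I_m * 'I_n])
        preimage_set_system setT (fun X : 'M[R]_(m, n) => X ij.1 ij.2)
          (measurable : set (set R)) >>.

Let mx_sigma0 : mx_sigma set0.
Proof. exact: sigma_algebra0. Qed.

Let mx_sigmaC A : mx_sigma A -> mx_sigma (~` A).
Proof. exact: sigma_algebraC. Qed.

Let mx_sigma_bigcup (F : (set 'M[R]_(m, n))^nat) :
  (forall i, mx_sigma (F i)) -> mx_sigma (\bigcup_i (F i)).
Proof. exact: sigma_algebra_bigcup. Qed.

HB.instance Definition _ := @isMeasurable.Build default_measure_display
  'M[R]_(m, n) mx_sigma mx_sigma0 mx_sigmaC mx_sigma_bigcup.

End measurable_matrix.

Definition qform (R : realType) (n : nat) (Q : 'M[R]_n) (x : 'cV[R]_n) : R :=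
  (x^T *m Q *m x) 0 0.

Definition posdefmx (R : realType) (n : nat) (Q : 'M[R]_n) : Prop :=
  Q^T = Q /\ forall x : 'cV[R]_n, x != 0 -> 0 < qform Q x.

Definition mutually_independent d (T : measurableType d) (R : realType)
    (P : probability T R) (I : Type) (F : I -> set (set T)) : Prop :=
  forall (n : nat) (i : 'I_n -> I) (E : 'I_n -> set T),
    injective i -> (forall j, F (i j) (E j)) ->
    P (\bigcap_(j in [set: 'I_n]) E j) = (\prod_(j < n) P (E j))%E.

Record plant (R : realType) (S Nr Nt : nat) := Plant {
  matA : 'M[R]_S ;
  matB : 'M[R]_(S, Nr) ;
  covW : 'M[R]_S ;
  costQ : 'M[R]_S ;
  costR : 'M[R]_Nt ;
  costM : 'M[R]_Nr }.

Record randomness d (T : measurableType d) (R : realType)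
    (P : probability T R) (S Nr Nt : nat) := Randomness {
  init : {RV P >-> 'cV[R]_S} ;
  chan : nat -> {RV P >-> 'M[R]_(Nr, Nt)} ;
  active : nat -> {RV P >-> bool} ;
  rxnoise : nat -> {RV P >-> 'cV[R]_Nr} ;
  plnoise : nat -> {RV P >-> 'cV[R]_S} }.

Inductive source (Nr Nt : nat) :=
  | SrcInit
  | SrcChan of nat & 'I_Nr & 'I_Nt
  | SrcActive of nat
  | SrcRxnoise of nat & 'I_Nr
  | SrcPlnoise of nat.

(* Extended states (x, H, delta). *)
Notation ext_state R S Nr Nt := ('cV[R]_S * 'M[R]_(Nr, Nt) * bool)%type.

Section control.
Context d (T : measurableType d) (R : realType) (P : probability T R).
Variables (S Nr Nt : nat).
Variables (p : plant R S Nr Nt) (N : randomness P S Nr Nt).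

Local Notation state := (ext_state R S Nr Nt).

Definition source_events (s : source Nr Nt) : set (set T) :=
  match s with
  | SrcInit => g_sigma_algebra_preimage (init N)
  | SrcChan k i j =>
      g_sigma_algebra_preimage (fun w => chan N k w i j : R)
  | SrcActive k => g_sigma_algebra_preimage (active N k)
  | SrcRxnoise k i =>
      g_sigma_algebra_preimage (fun w => rxnoise N k w i 0 : R)
  | SrcPlnoise k => g_sigma_algebra_preimage (plnoise N k)
  end.

(* Independence of the whole family at once yields the independence of the
   entries of each H_k and v_k, the independence over time, and the mutual
   independence of the four processes and of the initial state. *)
Definition standing_assumptions : Prop :=
  [/\ mutually_independent P source_events,
      (forall k i j (A : set R), measurable A ->
         P [set w | A (chan N k w i j)] = normal_prob 0 1 A) /\
      (forall k i (A : set R), measurable A ->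
         P [set w | A (rxnoise N k w i 0)] = normal_prob 0 1 A),
      (forall k (A : set bool),
         P (active N k @^-1` A) = P (active N 0%N @^-1` A)),
      (forall k (A : set 'cV[R]_S), measurable A ->
         P (plnoise N k @^-1` A) = P (plnoise N 0%N @^-1` A)) &
      forall k i,
        [/\ (fun w => plnoise N k w i 0%R) \in Lfun P 2%:E,
            'E_P[fun w => plnoise N k w i 0%R]%E = 0%E &
            forall j, covariance P (fun w => plnoise N k w i 0%R)
                        (fun w => plnoise N k w j 0%R) = (covW p i j)%:E]].

Definition received (s : state) (u : 'cV[R]_Nt) (v : 'cV[R]_Nr) : 'cV[R]_Nr :=
  s.2%:R *: (s.1.2 *m u) + v.

Definition step (s : state) (u : 'cV[R]_Nt) (v : 'cV[R]_Nr) (w : 'cV[R]_S) :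
    'cV[R]_S :=
  matA p *m s.1.1 + matB p *m received s u v + w.

Definition is_policy (pi : nat -> state -> 'cV[R]_Nt) : Prop :=
  forall k, measurable_fun [set: state] (pi k).

Fixpoint xproc (pi : nat -> state -> 'cV[R]_Nt) (k : nat) (w : T) : 'cV[R]_S :=
  if k is j.+1 then
    let s := (xproc pi j w, chan N j w, active N j w) in
    step s (pi j s) (rxnoise N j w) (plnoise N j w)
  else init N w.

Definition sproc pi (k : nat) (w : T) : state :=
  (xproc pi k w, chan N k w, active N k w).

Local Open Scope ereal_scope.

(* S_k is independent of (v_k, w_k, H_(k+1), delta_(k+1)), whose law does not
   depend on k. Conditional expectations given S_k = s and u_k = u are hence
   expectations over these variables with s and u frozen; k = 0 is used as the
   representative time. *)
Definition stage_cost (s : state) (u : 'cV[R]_Nt) : \bar R :=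
  (qform (costQ p) s.1.1 + qform (costR p) u)%:E +
  'E_P[fun w => qform (costM p) (received s u (rxnoise N 0%N w))].

Definition avg_cost pi : \bar R :=
  limn_esup (fun K : nat => (K%:R^-1)%:E *
    \sum_(0 <= k < K.+1)
      \int[P]_w stage_cost (sproc pi k w) (pi k (sproc pi k w))).

Definition optimal_policy pi : Prop :=
  is_policy pi /\ forall pi', is_policy pi' -> avg_cost pi <= avg_cost pi'.

(* The expectation may be +oo for some actions u. *)
Definition bellman_rhs (V : state -> R) (s : state) (u : 'cV[R]_Nt) : \bar R :=
  stage_cost s u +
  'E_P[fun w => V (step s u (rxnoise N 0%N w) (plnoise N 0%N w),
                   chan N 1%N w, active N 1%N w)].

Definition attains_min (V : state -> R) (s : state) (u : 'cV[R]_Nt) : Prop :=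
  forall u', bellman_rhs V s u <= bellman_rhs V s u'.

(* m s = min_u (bellman_rhs V s u) for every s, the minimum being attained by a
   measurable function of the extended state. *)
Definition is_bellman_min (V m : state -> R) : Prop :=
  exists2 g : state -> 'cV[R]_Nt, measurable_fun [set: state] g &
    forall s, attains_min V s (g s) /\ (m s)%:E = bellman_rhs V s (g s).

Definition extended_bellman (theta : R) (V : state -> R) : Prop :=
  is_bellman_min V (fun s => theta + V s)%R.

Definition lift_value (Vr : 'cV[R]_S -> R) : state -> R := fun s => Vr s.1.1.

Definition mean_value (V : state -> R) (k : nat) (x : 'cV[R]_S) : \bar R :=
  'E_P[fun w => V (x, chan N k w, active N k w)].

Definition reduced_bellman (theta : R) (Vr : 'cV[R]_S -> R) : Prop :=
  exists2 m : state -> R, is_bellman_min (lift_value Vr) m &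
    forall x, (theta + Vr x)%:E = mean_value m 0 x.

(* The class in which solutions of Bellman equations are sought. Without it
   spurious solutions exist: for scalar x, A = 2, Q = 1 and delta_k = 0 a.s.,
   V x = - x^2 / 3 solves the reduced equation although every policy has
   infinite cost whenever the noise B v_k + w_k is not degenerate. The last
   condition is a transversality condition; it holds as soon as V s is at most
   c * (1 + |x|^2), by positive definiteness of Q. *)
Definition admissible_value (V : state -> R) : Prop :=
  [/\ measurable_fun [set: state] V,
      (exists c : R, forall s, (c <= V s)%R),
      'E_P[fun w => V (init N w, chan N 0%N w, active N 0%N w)] < +oo &
      forall pi, is_policy pi -> avg_cost pi < +oo ->
        limn_einf (fun K : nat => (K%:R^-1)%:E * 'E_P[V \o sproc pi K]) <= 0].

End control.

(* Main.v *)
(* Put V s := m s - theta, where m is the minimum in the reduced equation. Given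
   x_k, the pair (H_k, delta_k) is independent of x_k with a law independent of
   k, so averaging V over it gives back Vr, and V and Vr have the same expected
   continuation values: V solves the extended equation with the same minimizers.

   For a solution V of an extended equation, S_k is independent of the noise that
   drives the transition, so that E[bellman_rhs V S_k u_k] = r_k + a_(k+1), where
   r_k is the expected stage cost and a_k := E[V(S_k)]. Hence theta + a_k <=
   r_k + a_(k+1), with equality for minimizers; this telescopes to
   K theta + a_0 <= sum_(k < K) r_k + a_K. The lower bound on V gives the upper
   bound on the average cost of minimizers, and the transversality condition
   gives the lower bound for all policies, so that theta is also unique. *)
Require Import Defs.
From HB Require Import structures.
From mathcomp Require Import all_boot all_order all_algebra.
From mathcomp Require Import all_classical all_reals all_analysis.
From mathcomp Require Import measurable_realfun ring.

Set Implicit Arguments.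
Unset Strict Implicit.
Unset Printing Implicit Defensive.

Import Order.TTheory GRing.Theory Num.Theory.
Import numFieldNormedType.Exports.

Local Open Scope classical_set_scope.
Local Open Scope ring_scope.
Local Open Scope ereal_scope.

(** * Independence of generated sigma-algebras *)

Section independent_sigma_algebras.
Context d (T : measurableType d) (R : realType) (P : probability T R).

(** For fixed [B] both sides are finite measures in [A]: the restriction of [P] to [B], and [P]
    scaled by [P B]. They agree on the pi-system [G], which contains [setT], hence on the
    sigma-algebra that it generates. *)
Lemma sigma_indep_l (G : set (set T)) (B : set T) :
  (forall A, G A -> measurable A) -> setI_closed G -> G setT -> measurable B ->
  (forall A, G A -> P (A `&` B) = P A * P B) ->
  forall A, <<s G >> A -> P (A `&` B) = P A * P B.
Proof.
move=> mG GI GT mB GB A sA.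
pose k : {nonneg R} := NngNum (fine_ge0 (measure_ge0 P B)).
have kE : k%:num%:E = P B by rewrite /= fineK// fin_num_measure.
suff : mrestr P mB A = mscale k P A by rewrite /mscale kE muleC.
apply: (g_sigma_algebra_measure_unique G mG (fun=> setT)) => //=.
- by rewrite bigcup_const//; exists 0%N.
- by move=> C GC; rewrite /mscale kE muleC; exact: GB.
- by move=> _; rewrite /mrestr setTI ltey_eq fin_num_measure.
Qed.

Variables (I : choiceType) (F : I -> set (set T)).
Hypothesis mF : forall i A, F i A -> measurable A.
Hypothesis FT : forall i, F i setT.
Hypothesis FI : forall i, setI_closed (F i).
Hypothesis indepF : mutually_independent P F.

(* The pi-system of finite intersections of events of the sources in J. Indexing
   them by families that are setT almost everywhere makes intersections pointwise. *)
Let box (J : set I) : set (set T) := [set A | exists E : I -> set T,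
  [/\ forall i, F i (E i), finite_set [set i | E i <> setT],
      forall i, ~ J i -> E i = setT & A = \bigcap_i E i]].

Let boxT J : box J setT.
Proof.
exists (fun=> setT); split => //.
  by rewrite (_ : [set _ | _] = set0)//; apply/seteqP; split => // i.
by apply/seteqP; split.
Qed.

Let box_measurable J A : box J A -> measurable A.
Proof.
move=> [E [FE /finite_seqP[s sE] _ ->]].
have -> : \bigcap_i E i = \bigcap_(i in [set` s]) E i.
  apply/seteqP; split => t tE i _; first exact: tE.
  have [si|] := boolP (i \in s); first exact: tE.
  move=> /negP si; suff -> : E i = setT by [].
  by apply: contrapT => Ei; apply: si; have : [set` s] i by rewrite -sE.
by apply: fin_bigcap_measurable => // i _; exact: mF.
Qed.

Let box_setI J : setI_closed (box J).
Proof.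
move=> _ _ [E [FE fE JE ->]] [E' [FE' fE' JE' ->]].
exists (fun i => E i `&` E' i); split => [i||i Ji|].
- exact: FI.
- apply: sub_finite_set (_ : _ `<=` [set i | E i <> setT] `|` [set i | E' i <> setT]) _.
    move=> i /= EE'; apply/not_andP => -[Ei E'i].
    by apply: EE'; rewrite Ei E'i setIT.
  by rewrite finite_setU.
- by rewrite JE ?JE' ?setIT.
- by rewrite bigcapI.
Qed.

Let box_sub i J A : J i -> F i A -> box J A.
Proof.
move=> Ji FA; exists (fun j => if j == i then A else setT); split => [j||j Jj|].
- by case: eqVneq => [->|].
- apply: sub_finite_set (finite_set1 i) => j /=.
  by case: eqVneq.
- by case: eqVneq => // ij; rewrite ij in Jj.
- apply/seteqP; split => [t At j _|t /(_ i Logic.I)]; last by rewrite eqxx.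
  by case: eqVneq.
Qed.

(** Independence speaks of injective families indexed by ordinals. A duplicate-free list is such a
    family, and the indices outside it contribute only [setT]. *)
Let prob_bigcap (s : seq I) (E : I -> set T) : uniq s ->
  (forall i, F i (E i)) -> (forall i, i \notin s -> E i = setT) ->
  P (\bigcap_i E i) = \prod_(i <- s) P (E i).
Proof.
move=> us FE Es.
have -> : \bigcap_i E i =
    \bigcap_(j in [set: 'I_(size s)]) E (tnth (in_tuple s) j).
  apply/seteqP; split => [t tE j _|t tE i _]; first exact: tE.
  have [si|/Es->//] := boolP (i \in s).
  have /tnthP[j ->] : i \in in_tuple s by [].
  exact: tE.
rewrite (@indepF (size s) (tnth (in_tuple s)) (fun j => E (tnth (in_tuple s) j)))//.
  by rewrite [RHS]big_tnth.
exact/tuple_uniqP.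
Qed.

(** Both boxes are written over one finite list of indices. As [J1] and [J2] are disjoint, one of
    the two events is [setT] at each index, so the product splits factor by factor. *)
Let box_indep J1 J2 A B : (forall i, J1 i -> J2 i -> False) ->
  box J1 A -> box J2 B -> P (A `&` B) = P A * P B.
Proof.
move=> J12 [E [FE /finite_seqP[s sE] JE ->]] [E' [FE' /finite_seqP[s' s'E] JE' ->]].
pose r := undup (s ++ s').
have rE i : i \notin r -> E i = setT /\ E' i = setT.
  rewrite mem_undup mem_cat negb_or => /andP[/negP si /negP s'i]; split.
  - by apply: contrapT => Ei; apply: si; have : [set` s] i by rewrite -sE.
  - by apply: contrapT => Ei; apply: s'i; have : [set` s'] i by rewrite -s'E.
rewrite -bigcapI.
rewrite (@prob_bigcap r)//; [|exact: undup_uniq|by move=> i; exact: FI|]; last first.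
  by move=> i /rE[-> ->]; rewrite setIT.
rewrite (@prob_bigcap r E)//; [|exact: undup_uniq|by move=> i /rE[]].
rewrite (@prob_bigcap r E')//; [|exact: undup_uniq|by move=> i /rE[]].
rewrite -big_split/=; apply: eq_bigr => i _.
have [Ji|Ji] := pselect (J1 i).
  by rewrite (JE' i) ?setIT ?probability_setT ?mule1// => /(J12 _ Ji).
by rewrite (JE i) ?setTI ?probability_setT ?mul1e.
Qed.

(** [sigma_indep_l] passes from boxes to the generated sigma-algebra one argument at a time, so it
    is used twice. *)
Lemma sigma_indep (J1 J2 : set I) A B : (forall i, J1 i -> J2 i -> False) ->
  <<s \bigcup_(i in J1) F i >> A -> <<s \bigcup_(i in J2) F i >> B ->
  P (A `&` B) = P A * P B.
Proof.
move=> J12 sA sB.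
have sbox J : <<s \bigcup_(i in J) F i >> `<=` <<s box J >>.
  by apply: sub_sigma_algebra2 => C [i Ji FC]; exact: box_sub FC.
have mbox J : <<s box J >> `<=` measurable.
  by apply: smallest_sub; [exact: sigma_algebra_measurable|exact: box_measurable].
have {}sA := sbox _ _ sA; have {}sB := sbox _ _ sB.
apply: (sigma_indep_l (@box_measurable J1)) sA => //; first exact: mbox sB.
move=> {}A bA; rewrite setIC muleC.
apply: (sigma_indep_l (@box_measurable J2)) sB => //; first exact: box_measurable bA.
by move=> {}B bB; rewrite setIC muleC; exact: box_indep bA bB.
Qed.

End independent_sigma_algebras.

(** * Integrals and joint laws *)

(* The functions integrated below are bounded from below but may have infinite
   integral, so the lemmas on integrable functions do not apply: nonnegativity is
   recovered by adding a constant. *)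
Section bounded_below_integrals.
Context d (T : measurableType d) (R : realType) (P : probability T R).
Implicit Types f g : T -> \bar R.

Lemma integral_cstP (a : R) : \int[P]_t (cst a%:E) t = a%:E.
Proof. by rewrite integral_cst// [X in _ * X]probability_setT mule1. Qed.

(** The negative part of [f] is at most [a], so its integral is finite. In (f + a) + f^- = f^+ + a
    all the summands f + a, f^-, f^+, a are nonnegative; integrating termwise and cancelling the
    integral of f^- gives the claim. *)
Lemma integral_addr_const f (a : R) : measurable_fun [set: T] f ->
  (0 <= a)%R -> (forall t, (- a)%:E <= f t) ->
  \int[P]_t (f t + a%:E) = \int[P]_t f t + a%:E.
Proof.
move=> mf a0 fa.
have fna t : f^\- t <= a%:E.
  by rewrite funenegE ge_max lee_fin a0 andbT leeNl.
have ifn : \int[P]_t f^\- t \is a fin_num.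
  rewrite ge0_fin_numE; last by apply: integral_ge0 => t _; exact: funeneg_ge0.
  apply: (@le_lt_trans _ _ (\int[P]_t (cst a%:E) t)); last first.
    by rewrite integral_cstP ltry.
  apply: ge0_le_integral => //; first exact: measurable_funeneg.
have fa0 t : 0 <= f t + a%:E by rewrite -leeBlDr// sub0e -EFinN.
have H : \int[P]_t (f t + a%:E) + \int[P]_t f^\- t =
    \int[P]_t f^\+ t + a%:E.
  transitivity (\int[P]_t (f t + a%:E + f^\- t)).
    rewrite [RHS]ge0_integralD//.
      exact: emeasurable_funD.
    exact: measurable_funeneg.
  transitivity (\int[P]_t (f^\+ t + (cst a%:E) t)).
    apply: eq_integral => t _ /=.
    rewrite [X in X + _ + _](congr1 (@^~ t) (funeposneg f)) addeAC subeK// ?addeC//.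
    rewrite fin_numElt (le_lt_trans (fna t))// ?ltry//.
    by rewrite (lt_le_trans ltNy0)// funeneg_ge0.
  rewrite ge0_integralD//; last exact: measurable_funepos.
  by rewrite integral_cstP.
by rewrite [\int[P]_t f t]integralE addeAC -H addeK.
Qed.

Lemma lb_integralD f g (a b : R) :
  measurable_fun [set: T] f -> measurable_fun [set: T] g ->
  (forall t, a%:E <= f t) -> (forall t, b%:E <= g t) ->
  \int[P]_t (f t + g t) = \int[P]_t f t + \int[P]_t g t.
Proof.
move=> mf mg fa gb.
have fa' t : (- `|a|)%:E <= f t.
  by apply: le_trans (fa t); rewrite lee_fin lerNl ler_normr lexx orbT.
have gb' t : (- `|b|)%:E <= g t.
  by apply: le_trans (gb t); rewrite lee_fin lerNl ler_normr lexx orbT.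
have : \int[P]_t (f t + g t + (`|a| + `|b|)%:E) =
    \int[P]_t (f t + `|a|%:E) + \int[P]_t (g t + `|b|%:E).
  transitivity (\int[P]_t ((f t + `|a|%:E) + (g t + `|b|%:E))).
    by apply: eq_integral => t _; rewrite addeACA.
  apply: ge0_integralD => //; try exact: emeasurable_funD.
    by move=> t _; rewrite -leeBlDr// sub0e -EFinN.
  by move=> t _; rewrite -leeBlDr// sub0e -EFinN.
rewrite !integral_addr_const//; last 2 first.
- exact: emeasurable_funD.
- by move=> t; rewrite opprD EFinD; exact: leeD.
rewrite addeACA => /(congr1 (fun x => x - (`|a| + `|b|)%:E)).
by rewrite addeK// -EFinD addeK.
Qed.

Lemma lb_le_integral f g : measurable_fun [set: T] f ->
  measurable_fun [set: T] g -> (forall t, f t <= g t) ->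
  \int[P]_t f t <= \int[P]_t g t.
Proof.
move=> mf mg fg; rewrite integralE [leRHS]integralE; apply: leeB.
  apply: ge0_le_integral => //; try exact: measurable_funepos.
  by move=> t _; apply: (@funepos_le _ _ setT) => [x _|]; rewrite ?inE.
apply: ge0_le_integral => //; try exact: measurable_funeneg.
by move=> t _; apply: (@funeneg_le _ _ setT) => [x _|]; rewrite ?inE.
Qed.

Lemma lb_integral_ge f (a : R) : measurable_fun [set: T] f ->
  (forall t, a%:E <= f t) -> a%:E <= \int[P]_t f t.
Proof. by move=> mf fa; rewrite -(integral_cstP a); exact: lb_le_integral. Qed.

Lemma lb_integralDr f (a b : R) : measurable_fun [set: T] f ->
  (forall t, a%:E <= f t) -> \int[P]_t (f t + b%:E) = \int[P]_t f t + b%:E.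
Proof.
move=> mf fa.
by rewrite -[X in _ = _ + X]integral_cstP (@lb_integralD f (cst b%:E) a b).
Qed.

(** Tonelli gives measurability for [f] shifted by [|a|]; the shift is then taken back outside the
    integral. *)
Lemma measurable_fun_lb_integral d' (U : measurableType d')
    (f : U * T -> \bar R) (a : R) : measurable_fun [set: U * T] f ->
  (forall z, a%:E <= f z) -> measurable_fun [set: U] (fun u => \int[P]_t f (u, t)).
Proof.
move=> mf fa.
have -> : (fun u => \int[P]_t f (u, t)) =
    (fun u => \int[P]_t (f (u, t) + `|a|%:E) + (- `|a|)%:E).
  apply/funext => u; rewrite (@lb_integralDr _ a)//.
    by rewrite -addeA -EFinD subrr adde0.
  exact: measurableT_comp.
apply: emeasurable_funD => //.
apply: (@measurable_fun_fubini_tonelli_F _ _ _ _ _ P (fun z => f z + `|a|%:E)).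
  exact: emeasurable_funD.
move=> z; rewrite -leeBlDr// sub0e -EFinN; apply: le_trans (fa z).
by rewrite lee_fin lerNl ler_normr lexx orbT.
Qed.

End bounded_below_integrals.

(** * Iterated integrals under independence *)

Section joint_laws.
Context d (T : measurableType d) (R : realType) (P : probability T R).
Context d1 d2 (U : measurableType d1) (V : measurableType d2).

(* X and Y are independent; X0 and Y0 are copies with the same marginals. *)
Definition product_law (X X0 : T -> U) (Y Y0 : T -> V) : Prop :=
  forall A B, measurable A -> measurable B ->
    P (X @^-1` A `&` Y @^-1` B) = P (X0 @^-1` A) * P (Y0 @^-1` B).

Variables (X X0 : T -> U) (Y Y0 : T -> V).
Hypotheses (mX : measurable_fun [set: T] X) (mX0 : measurable_fun [set: T] X0).
Hypotheses (mY : measurable_fun [set: T] Y) (mY0 : measurable_fun [set: T] Y0).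
Hypothesis XY : product_law X X0 Y Y0.

(** [product_law] says that the law of [(X, Y)] agrees on rectangles with the product of the laws of
    [X0] and [Y0]. The two measures are then equal, and Tonelli applies to the product. *)
Let ge0_integral_product_law (f : U * V -> \bar R) :
  measurable_fun [set: U * V] f -> (forall z, 0 <= f z) ->
  \int[P]_t f (X t, Y t) = \int[P]_t \int[P]_t' f (X0 t, Y0 t').
Proof.
move=> mf f0.
have mXY : measurable_fun [set: T] (fun t => (X t, Y t)).
  exact: measurable_fun_pair.
pose pXY : {mfun T >-> (U * V)%type} :=
  HB.pack (fun t => (X t, Y t)) (isMeasurableFun.Build _ _ _ _ _ mXY).
pose pX0 : {mfun T >-> U} := HB.pack X0 (isMeasurableFun.Build _ _ _ _ _ mX0).
pose pY0 : {mfun T >-> V} := HB.pack Y0 (isMeasurableFun.Build _ _ _ _ _ mY0).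
have law A : measurable A -> (distribution P pX0 \x distribution P pY0) A =
    distribution P pXY A.
  apply: product_measure_unique => B C mB mC; exact: XY.
transitivity (\int[distribution P pXY]_z f z).
  by rewrite ge0_integral_pushforward.
transitivity (\int[(distribution P pX0 \x distribution P pY0)]_z f z).
  by apply: eq_measure_integral => A mA _; exact/esym/law.
rewrite fubini_tonelli1// ge0_integral_pushforward//; last 2 first.
- exact: measurable_fun_fubini_tonelli_F.
- by move=> x _; apply: integral_ge0.
apply: eq_integral => t _ /=; rewrite /fubini_F ge0_integral_pushforward//.
exact: measurableT_comp.
Qed.

(** This justifies computing a conditional expectation given [X] by freezing its value in the inner
    integral, with [Y0] standing in for [Y]. *)
Lemma integral_product_law (f : U * V -> \bar R) (a : R) :
  measurable_fun [set: U * V] f -> (forall z, a%:E <= f z) ->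
  \int[P]_t f (X t, Y t) = \int[P]_t \int[P]_t' f (X0 t, Y0 t').
Proof.
move=> mf fa.
have mfX0 x : measurable_fun [set: T] (fun t => f (x, Y0 t)).
  by apply: (measurableT_comp mf); exact: measurable_fun_pair.
have E : \int[P]_t (f (X t, Y t) + `|a|%:E) =
    \int[P]_t \int[P]_t' (f (X0 t, Y0 t') + `|a|%:E).
  apply: (ge0_integral_product_law (f := fun z => f z + `|a|%:E)).
    exact: emeasurable_funD.
  move=> z; rewrite -leeBlDr// sub0e -EFinN; apply: le_trans (fa z).
  by rewrite lee_fin lerNl ler_normr lexx orbT.
have inner t : \int[P]_t' (f (X0 t, Y0 t') + `|a|%:E) =
    \int[P]_t' f (X0 t, Y0 t') + `|a|%:E by exact: (@lb_integralDr _ _ _ _ _ a).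
rewrite (eq_integral _ _ (fun t _ => inner t)) in E.
move: E; rewrite (@lb_integralDr _ _ _ _ (fun t => f (X t, Y t)) a)//; last first.
  by apply: (measurableT_comp mf); exact: measurable_fun_pair.
rewrite (@lb_integralDr _ _ _ _ (fun t => \int[P]_t' f (X0 t, Y0 t')) a)//.
- by move=> /(congr1 (fun x => x - `|a|%:E)); rewrite !addeK.
- apply: (measurable_fun_lb_integral P (f := fun z => f (X0 z.1, Y0 z.2)) (a := a)) => //.
  apply: (measurableT_comp mf); apply: measurable_fun_pair.
    exact: measurableT_comp.
  exact: measurableT_comp.
- by move=> t; exact: lb_integral_ge.
Qed.

End joint_laws.

Definition same_law d (T : measurableType d) (R : realType)
    (P : probability T R) d1 (U : measurableType d1) (X X' : T -> U) : Prop :=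
  forall A, measurable A -> P (X @^-1` A) = P (X' @^-1` A).

(** Applied to an indicator, [integral_product_law] expresses both joint laws by the same iterated
    integral over [X0] and [Y0]. *)
Lemma product_law_same d (T : measurableType d) (R : realType)
    (P : probability T R) d1 d2 (U : measurableType d1) (V : measurableType d2)
    (X X' X0 : T -> U) (Y Y' Y0 : T -> V) :
  measurable_fun [set: T] X -> measurable_fun [set: T] X' ->
  measurable_fun [set: T] X0 ->
  measurable_fun [set: T] Y -> measurable_fun [set: T] Y' ->
  measurable_fun [set: T] Y0 ->
  product_law P X X0 Y Y0 -> product_law P X' X0 Y' Y0 ->
  same_law P (fun t => (X t, Y t)) (fun t => (X' t, Y' t)).
Proof.
move=> mX mX' mX0 mY mY' mY0 XY XY' A mA.
have mf : measurable_fun [set: U * V] (fun z => (\1_A z : R)%:E).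
  by apply/measurable_EFinP; exact: measurable_indic.
have H (Z : T -> U * V) : measurable_fun [set: T] Z ->
    P (Z @^-1` A) = \int[P]_t (\1_A (Z t))%:E.
  move=> mZ; rewrite -[in LHS](setIT (_ @^-1` _)) -integral_indic//.
  by rewrite -[_ @^-1` _]setTI; exact: mZ.
rewrite !H; [|exact: measurable_fun_pair..].
have f0 z : 0%:E <= (\1_A z : R)%:E by rewrite lee_fin.
by rewrite (integral_product_law mX mX0 mY mY0 XY mf f0)
  (integral_product_law mX' mX0 mY' mY0 XY' mf f0).
Qed.

(** * Random matrices *)

(** Enumerating [K] reduces to ordinals; this form suits matrix entries, whose indices are pairs. *)
Lemma mutually_independent_fin d (T : measurableType d) (R : realType)
    (P : probability T R) (I : Type) (F : I -> set (set T)) (K : finType)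
    (c : K -> I) (E : K -> set T) :
  mutually_independent P F -> injective c -> (forall k, F (c k) (E k)) ->
  P (\bigcap_k E k) = \prod_k P (E k).
Proof.
move=> indepF cI FE.
rewrite (reindex (fun j : 'I_#|K| => enum_val j)) /=; last exact/onW_bij/enum_val_bij.
rewrite -(indepF _ (fun j : 'I_#|K| => c (enum_val j))
  (fun j : 'I_#|K| => E (enum_val j))) => [|j j' /cI/enum_val_inj//|j]; last exact: FE.
congr (P _); apply/seteqP; split => [w Ew j _|w Ew k _]; first exact: Ew.
by rewrite -(enum_rankK k); exact: Ew.
Qed.

Section measurable_matrices.
Context (R : realType).

Lemma measurable_mx_entry m n i j :
  measurable_fun [set: 'M[R]_(m, n)] (fun X : 'M[R]_(m, n) => X i j).
Proof.
move=> _ B mB; apply: sub_sigma_algebra; exists (i, j) => //=.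
by exists B.
Qed.

Section measurable_functions.
Context d (T : measurableType d).

Lemma measurable_fun_mxP m n (f : T -> 'M[R]_(m, n)) :
  measurable_fun [set: T] f <->
  forall i j, measurable_fun [set: T] (fun t => f t i j).
Proof.
split=> [mf i j|mf]; first exact: measurableT_comp (measurable_mx_entry i j) mf.
apply: (@measurability _ _ _ _ _ _ (\bigcup_(ij in [set: 'I_m * 'I_n])
    preimage_set_system setT (fun X : 'M[R]_(m, n) => X ij.1 ij.2)
      (measurable : set (set R)))) => //.
move=> _ [_ [ij _ [B mB <-]] <-]; rewrite setTI preimage_setI preimage_setT setTI.
by have := mf ij.1 ij.2 measurableT B mB; rewrite setTI.
Qed.

Lemma measurable_fun_mulmx m n q (f : T -> 'M[R]_(m, n)) (g : T -> 'M[R]_(n, q)) :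
  measurable_fun [set: T] f -> measurable_fun [set: T] g ->
  measurable_fun [set: T] (fun t => f t *m g t)%R.
Proof.
move=> /measurable_fun_mxP mf /measurable_fun_mxP mg.
apply/measurable_fun_mxP => i j.
under eq_fun do rewrite mxE.
by apply: measurable_sum => k; exact: measurable_funM.
Qed.

Lemma measurable_fun_addmx m n (f g : T -> 'M[R]_(m, n)) :
  measurable_fun [set: T] f -> measurable_fun [set: T] g ->
  measurable_fun [set: T] (fun t => f t + g t)%R.
Proof.
move=> /measurable_fun_mxP mf /measurable_fun_mxP mg.
apply/measurable_fun_mxP => i j.
by under eq_fun do rewrite mxE; exact: measurable_funD.
Qed.

Lemma measurable_fun_scalemx m n (a : T -> R) (f : T -> 'M[R]_(m, n)) :
  measurable_fun [set: T] a -> measurable_fun [set: T] f ->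
  measurable_fun [set: T] (fun t => a t *: f t)%R.
Proof.
move=> ma /measurable_fun_mxP mf; apply/measurable_fun_mxP => i j.
by under eq_fun do rewrite mxE; exact: measurable_funM.
Qed.

Lemma measurable_fun_qform n (Q : 'M[R]_n) (f : T -> 'cV[R]_n) :
  measurable_fun [set: T] f -> measurable_fun [set: T] (fun t => qform Q (f t)).
Proof.
move=> mf.
suff /measurable_fun_mxP : measurable_fun [set: T] (fun t => (f t)^T *m Q *m f t)%R.
  exact.
apply: measurable_fun_mulmx => //; apply: measurable_fun_mulmx => //.
move/measurable_fun_mxP : mf => mf; apply/measurable_fun_mxP => i j.
by under eq_fun do rewrite mxE; exact: mf.
Qed.

End measurable_functions.

(** Entrywise rectangles are stable under intersection and generate the sigma-algebra of matrices,
    so they determine a probability law. *)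
Lemma same_law_mx d (T : measurableType d) (P : probability T R) m n
    (X X' : T -> 'M[R]_(m, n)) :
  measurable_fun [set: T] X -> measurable_fun [set: T] X' ->
  (forall A : 'I_m * 'I_n -> set R, (forall ij, measurable (A ij)) ->
    P (\bigcap_ij [set t | A ij (X t ij.1 ij.2)]) =
    P (\bigcap_ij [set t | A ij (X' t ij.1 ij.2)])) ->
  same_law P X X'.
Proof.
move=> mX mX' XX' B mB.
pose pX : {mfun T >-> 'M[R]_(m, n)} :=
  HB.pack X (isMeasurableFun.Build _ _ _ _ _ mX).
pose pX' : {mfun T >-> 'M[R]_(m, n)} :=
  HB.pack X' (isMeasurableFun.Build _ _ _ _ _ mX').
pose G : set (set 'M[R]_(m, n)) := [set C | exists2 A : 'I_m * 'I_n -> set R,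
  (forall ij, measurable (A ij)) & C = \bigcap_ij [set Z : 'M[R]_(m, n) | A ij (Z ij.1 ij.2)]].
apply: (@measure_unique _ R _ G (fun=> setT) _ _ _ _ (distribution P pX)
  (distribution P pX') _ _ B mB).
- apply/seteqP; split.
    apply: sub_sigma_algebra2 => _ [ij _ [C mC <-]]; rewrite setTI.
    (* An event on one entry is a rectangle with [setT] at all other entries. *)
    exists (fun kl => if kl == ij then C else setT) => [kl|].
      by case: ifPn.
    apply/seteqP; split => [Z CZ kl _|Z /(_ ij Logic.I)/=]; last by rewrite eqxx.
    by case: eqVneq => //= ->.
  apply: smallest_sub; first exact: sigma_algebra_measurable.
  move=> _ [A mA ->].
  rewrite (_ : bigcap _ _ = \bigcap_(ij in [set` enum {: 'I_m * 'I_n}])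
      [set Z : 'M[R]_(m, n) | A ij (Z ij.1 ij.2)]).
    apply: fin_bigcap_measurable => // ij _.
    by rewrite -[X in measurable X]setTI; exact: measurable_mx_entry.
  apply/seteqP; split => Z AZ ij _; first exact: AZ.
  by apply: AZ; rewrite /= mem_enum.
- move=> _ _ [A mA ->] [A' mA' ->]; exists (fun ij => A ij `&` A' ij).
    by move=> ij; exact: measurableI.
  by rewrite -bigcapI.
- by move=> _; exists (fun=> setT) => //; apply/seteqP; split.
- by rewrite bigcup_const//; exists 0%N.
- by move=> _ [A mA ->]; exact: XX'.
- by move=> _; rewrite ltey_eq fin_num_measure.
Qed.

End measurable_matrices.

(** * Randomness of the plant *)

Section sources.
Context d (T : measurableType d) (R : realType) (P : probability T R).
Variables (S Nr Nt : nat) (p : plant R S Nr Nt) (N : randomness P S Nr Nt).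

Definition source_sigma (J : set (source Nr Nt)) : set (set T) :=
  \bigcup_(s in J) source_events N s.

(** Measurability for the sigma-algebra of the sources in [J] expresses that [X] is a function of
    these sources. Changing only the measurable structure of [T] lets the usual closure lemmas for
    measurable functions apply. *)
Definition depends_on (J : set (source Nr Nt)) d' (U : measurableType d')
    (X : T -> U) : Prop :=
  measurable_fun [set: g_sigma_algebraType (source_sigma J)]
    (X : g_sigma_algebraType (source_sigma J) -> U).

Lemma depends_on_source J s d' (U : measurableType d') (X : T -> U) :
  J s -> (forall B, measurable B -> source_events N s (X @^-1` B)) ->
  depends_on J X.
Proof.
by move=> Js sX _ B mB; rewrite setTI; apply: sub_sigma_algebra; exists s => //; exact: sX.
Qed.

Lemma preimage_in_sigma d' (U : measurableType d') (X : T -> U) B :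
  measurable B -> g_sigma_algebra_preimage X (X @^-1` B).
Proof. by move=> mB; exists B; rewrite ?setTI. Qed.

Lemma depends_on_init (J : set (source Nr Nt)) :
  J (SrcInit Nr Nt) -> depends_on J (init N).
Proof. by move=> Js; apply: depends_on_source Js _ => B; exact: preimage_in_sigma. Qed.

Lemma depends_on_active (J : set (source Nr Nt)) k :
  J (SrcActive Nr Nt k) -> depends_on J (active N k).
Proof. by move=> Js; apply: depends_on_source Js _ => B; exact: preimage_in_sigma. Qed.

Lemma depends_on_plnoise (J : set (source Nr Nt)) k :
  J (SrcPlnoise Nr Nt k) -> depends_on J (plnoise N k).
Proof. by move=> Js; apply: depends_on_source Js _ => B; exact: preimage_in_sigma. Qed.

Lemma depends_on_chan (J : set (source Nr Nt)) k :
  (forall i j, J (SrcChan k i j)) -> depends_on J (chan N k).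
Proof.
move=> Js; apply/measurable_fun_mxP => i j.
by apply: depends_on_source (Js i j) _ => B; exact: preimage_in_sigma.
Qed.

Lemma depends_on_rxnoise (J : set (source Nr Nt)) k :
  (forall i, J (SrcRxnoise Nt k i)) -> depends_on J (rxnoise N k).
Proof.
move=> Js; apply/measurable_fun_mxP => i j; rewrite (ord1 j).
by apply: depends_on_source (Js i) _ => B; exact: preimage_in_sigma.
Qed.

Lemma measurable_source s A : source_events N s A -> measurable A.
Proof.
case: s => [|k i j|k|k i|k] [B mB <-].
- exact: measurable_funP.
- exact: (measurableT_comp (measurable_mx_entry i j) (measurable_funP (chan N k))).
- exact: measurable_funP.
- exact: (measurableT_comp (measurable_mx_entry i 0%R) (measurable_funP (rxnoise N k))).
- exact: measurable_funP.
Qed.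

Lemma depends_on_measurable J d' (U : measurableType d') (X : T -> U) :
  depends_on J X -> measurable_fun [set: T] X.
Proof.
move=> mX _ B mB; move: (mX measurableT B mB); rewrite !setTI.
apply: smallest_sub; first exact: sigma_algebra_measurable.
by move=> A [s _]; exact: measurable_source.
Qed.

Hypothesis SA : standing_assumptions p N.

(** Each source contributes a sigma-algebra, in particular a pi-system, so [sigma_indep] applies.
    The copy [Y'] serves to replace the noise of time k by that of the reference time 0. *)
Lemma depends_on_indep (J1 J2 : set (source Nr Nt)) d1 d2
    (U : measurableType d1) (V : measurableType d2)
    (X : T -> U) (Y Y' : T -> V) :
  (forall s, J1 s -> J2 s -> False) -> depends_on J1 X -> depends_on J2 Y ->
  same_law P Y Y' -> product_law P X X Y Y'.
Proof.
move=> J12 mX mY YY' A B mA mB; rewrite -(YY' _ mB).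
apply: (@sigma_indep _ _ _ P {classic source Nr Nt} (source_events N) _ _ _ _ J1 J2) => //.
- exact: measurable_source.
- by case=> [|k i j|k|k i|k]; exists setT => //; rewrite setTI preimage_setT.
- by case=> [|k i j|k|k i|k] _ _ [C mC <-] [D mD <-]; exists (C `&` D);
    rewrite ?preimage_setI ?setTI//; exact: measurableI.
- by case: SA.
- by rewrite -[X @^-1` A]setTI; exact: mX.
- by rewrite -[Y @^-1` B]setTI; exact: mY.
Qed.

(** The entries of both matrices are independent standard normal variables, so every rectangle has
    the same product as probability. The injections [c] and [c'] name the source of each entry. *)
Lemma same_law_normal_mx m n (X X' : T -> 'M[R]_(m, n))
    (c c' : 'I_m * 'I_n -> source Nr Nt) :
  measurable_fun [set: T] X -> measurable_fun [set: T] X' ->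
  injective c -> injective c' ->
  (forall ij B, measurable B ->
    source_events N (c ij) [set t | B (X t ij.1 ij.2)] /\
    P [set t | B (X t ij.1 ij.2)] = normal_prob 0 1 B) ->
  (forall ij B, measurable B ->
    source_events N (c' ij) [set t | B (X' t ij.1 ij.2)] /\
    P [set t | B (X' t ij.1 ij.2)] = normal_prob 0 1 B) ->
  same_law P X X'.
Proof.
move=> mX mX' cI c'I cX c'X'; have [indep _ _ _ _] := SA.
apply: same_law_mx => // A mA.
rewrite (mutually_independent_fin (c := c) indep)//; last first.
  by move=> ij; exact: (cX ij _ (mA ij)).1.
rewrite (mutually_independent_fin (c := c') indep)//; last first.
  by move=> ij; exact: (c'X' ij _ (mA ij)).1.
apply: eq_bigr => ij _.
by rewrite (cX ij _ (mA ij)).2 (c'X' ij _ (mA ij)).2.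
Qed.

Lemma same_law_chan k l : same_law P (chan N k) (chan N l).
Proof.
have [_ [normH _] _ _ _] := SA.
apply: (same_law_normal_mx (c := fun ij => SrcChan k ij.1 ij.2)
  (c' := fun ij => SrcChan l ij.1 ij.2)) => //.
- by move=> [i j] [i' j'] [-> ->].
- by move=> [i j] [i' j'] [-> ->].
- by move=> ij B mB; split; [exact: preimage_in_sigma|exact: normH].
- by move=> ij B mB; split; [exact: preimage_in_sigma|exact: normH].
Qed.

Lemma same_law_rxnoise k l : same_law P (rxnoise N k) (rxnoise N l).
Proof.
have [_ [_ normv] _ _ _] := SA.
apply: (same_law_normal_mx (c := fun ij => SrcRxnoise Nt k ij.1)
  (c' := fun ij => SrcRxnoise Nt l ij.1)) => //.
- by move=> [i j] [i' j'] [->]; rewrite (ord1 j) (ord1 j').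
- by move=> [i j] [i' j'] [->]; rewrite (ord1 j) (ord1 j').
- by move=> [i j] B mB /=; rewrite (ord1 j); split; [exact: preimage_in_sigma|exact: normv].
- by move=> [i j] B mB /=; rewrite (ord1 j); split; [exact: preimage_in_sigma|exact: normv].
Qed.

Lemma same_law_active k l : same_law P (active N k) (active N l).
Proof. by have [_ _ act _ _] := SA; move=> A _; rewrite act [RHS]act. Qed.

Lemma same_law_plnoise k l : same_law P (plnoise N k) (plnoise N l).
Proof. by have [_ _ _ pln _] := SA; move=> A mA; rewrite pln// [RHS]pln. Qed.

Definition channel_sources k : set (source Nr Nt) := fun s =>
  match s with SrcChan j _ _ | SrcActive j => j = k | _ => False end.

Definition noise_sources k : set (source Nr Nt) := fun s =>
  match s with SrcRxnoise j _ | SrcPlnoise j => j = k | _ => False end.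

Lemma depends_on_channel (J : set (source Nr Nt)) k : channel_sources k `<=` J ->
  depends_on J (fun t => (chan N k t, active N k t)).
Proof.
move=> kJ; apply: measurable_fun_pair.
- by apply: depends_on_chan => i j; exact: kJ.
- by apply: depends_on_active; exact: kJ.
Qed.

Lemma depends_on_noise (J : set (source Nr Nt)) k : noise_sources k `<=` J ->
  depends_on J (fun t => (rxnoise N k t, plnoise N k t)).
Proof.
move=> kJ; apply: measurable_fun_pair.
- by apply: depends_on_rxnoise => i; exact: kJ.
- by apply: depends_on_plnoise; exact: kJ.
Qed.

Lemma same_law_channel k l :
  same_law P (fun t => (chan N k t, active N k t))
    (fun t => (chan N l t, active N l t)).
Proof.
have prod j : product_law P (chan N j) (chan N l) (active N j) (active N l).
  move=> A B mA mB; rewrite -(same_law_chan j l mA).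
  apply: (@depends_on_indep (fun s => if s is SrcChan _ _ _ then True else False)
    (fun s => if s is SrcActive _ then True else False)) mA mB.
  - by case.
  - exact: depends_on_chan.
  - exact: depends_on_active.
  - exact: same_law_active.
by apply: (product_law_same (X0 := chan N l) (Y0 := active N l)).
Qed.

Lemma same_law_noise k l :
  same_law P (fun t => (rxnoise N k t, plnoise N k t))
    (fun t => (rxnoise N l t, plnoise N l t)).
Proof.
have prod j : product_law P (rxnoise N j) (rxnoise N l) (plnoise N j) (plnoise N l).
  move=> A B mA mB; rewrite -(same_law_rxnoise j l mA).
  apply: (@depends_on_indep (fun s => if s is SrcRxnoise _ _ then True else False)
    (fun s => if s is SrcPlnoise _ then True else False)) mA mB.
  - by case.
  - exact: depends_on_rxnoise.
  - exact: depends_on_plnoise.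
  - exact: same_law_plnoise.
by apply: (product_law_same (X0 := rxnoise N l) (Y0 := plnoise N l)).
Qed.

(** All the randomness between the pair (S_k, u_k) and S_(k+1): the noises have time k, but the
    channel already has time k + 1. *)
Definition transition_noise k (t : T) :=
  ((rxnoise N k t, plnoise N k t), (chan N k.+1 t, active N k.+1 t)).

Lemma depends_on_transition_noise k :
  depends_on (noise_sources k `|` channel_sources k.+1) (transition_noise k).
Proof.
apply: measurable_fun_pair.
- by apply: depends_on_noise => s; left.
- by apply: depends_on_channel => s; right.
Qed.

Lemma same_law_transition_noise k l :
  same_law P (transition_noise k) (transition_noise l).
Proof.
have mnoise j : measurable_fun [set: T] (fun t => (rxnoise N j t, plnoise N j t)).
  exact: measurable_fun_pair.
have mchan j : measurable_fun [set: T] (fun t => (chan N j t, active N j t)).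
  exact: measurable_fun_pair.
have prod j : product_law P
    (fun t => (rxnoise N j t, plnoise N j t)) (fun t => (rxnoise N l t, plnoise N l t))
    (fun t => (chan N j.+1 t, active N j.+1 t)) (fun t => (chan N l.+1 t, active N l.+1 t)).
  move=> A B mA mB; rewrite -(same_law_noise j l mA).
  apply: (@depends_on_indep (noise_sources j) (channel_sources j.+1)) mA mB.
  - by case.
  - exact: depends_on_noise.
  - exact: depends_on_channel.
  - exact: same_law_channel.
exact: (product_law_same (mnoise k) (mnoise l) (mnoise l) (mchan k.+1)
  (mchan l.+1) (mchan l.+1)).
Qed.

(* x_k is a function of the initial state and of the sources of time < k. *)
Definition past_sources k : set (source Nr Nt) := fun s =>
  match s with
  | SrcInit => True
  | SrcChan j _ _ | SrcActive j | SrcRxnoise j _ | SrcPlnoise j => (j < k)%N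
  end.

(** The arbitrary domain [U] allows both [T] with the sigma-algebra of some sources and products of
    states, actions and noises. *)
Lemma measurable_step d' (U : measurableType d') (s : U -> ext_state R S Nr Nt)
    (u : U -> 'cV[R]_Nt) (v : U -> 'cV[R]_Nr) (w : U -> 'cV[R]_S) :
  measurable_fun [set: U] s -> measurable_fun [set: U] u ->
  measurable_fun [set: U] v -> measurable_fun [set: U] w ->
  measurable_fun [set: U] (fun z => step p (s z) (u z) (v z) (w z)).
Proof.
move=> ms mu mv mw; rewrite /step /received.
have ms1 : measurable_fun [set: U] (fun z => (s z).1) by exact: measurableT_comp.
have ms2 : measurable_fun [set: U] (fun z => (s z).2) by exact: measurableT_comp.
apply: measurable_fun_addmx => //; apply: measurable_fun_addmx.
  by apply: measurable_fun_mulmx => //; exact: measurableT_comp.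
apply: measurable_fun_mulmx => //; apply: measurable_fun_addmx => //.
apply: measurable_fun_scalemx; last first.
  by apply: measurable_fun_mulmx => //; exact: measurableT_comp.
exact: (measurableT_comp (f := fun b : bool => b%:R : R)).
Qed.

(** Allowing any [J] above the past sources builds in monotonicity: in the induction x_k and the
    variables of time k are measurable for one common sigma-algebra. *)
Lemma depends_on_xproc pi k (J : set (source Nr Nt)) : is_policy pi ->
  past_sources k `<=` J -> depends_on J (xproc p N pi k).
Proof.
move=> mpi; elim: k => [|k IH] kJ; first by apply: depends_on_init; exact: kJ.
have ms : depends_on J (fun t => (xproc p N pi k t, chan N k t, active N k t)).
  apply: measurable_fun_pair; first apply: measurable_fun_pair.
  - by apply: IH => s ks; apply: kJ; case: s ks => //= *; exact: ltnW.
  - by apply: depends_on_chan => i j; apply: kJ => /=.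
  - by apply: depends_on_active; apply: kJ => /=.
apply: measurable_step => //.
- exact: measurableT_comp (mpi k) ms.
- by apply: depends_on_rxnoise => i; apply: kJ => /=.
- by apply: depends_on_plnoise; apply: kJ => /=.
Qed.

Lemma depends_on_sproc pi k (J : set (source Nr Nt)) : is_policy pi ->
  past_sources k `<=` J -> channel_sources k `<=` J ->
  depends_on J (sproc p N pi k).
Proof.
move=> mpi kJ kJ'; apply: measurable_fun_pair; first apply: measurable_fun_pair.
- exact: depends_on_xproc.
- by apply: depends_on_chan => i j; exact: kJ'.
- by apply: depends_on_active; exact: kJ'.
Qed.

End sources.

(** * Long-run averages *)

Section average_cost_limits.
Context (R : realType).
Implicit Types u : nat -> \bar R.

Lemma limn_esup_lt_near u x : limn_esup u < x -> \forall n \near \oo, u n < x.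
Proof.
move=> /ereal_inf_lt[_ [V Voo <-] Vx]; apply: filterS Voo => n Vn.
by apply: le_lt_trans Vx; apply: ereal_sup_ubound; exists n.
Qed.

Lemma limn_esup_le_near u x : (\forall n \near \oo, u n <= x) -> limn_esup u <= x.
Proof.
move=> ux; apply: (@le_trans _ _ (ereal_sup (u @` [set n | u n <= x]))).
  by apply: ereal_inf_lbound; exists [set n | u n <= x].
by apply: ge_ereal_sup => _ [n ? <-].
Qed.

(** Used to find one index at which [u] is small and finitely many eventual properties hold as well.
    Otherwise -u would eventually be at most -(x + e), which contradicts the bound on the lower
    limit. *)
Lemma limn_einf_le_near u (x e : R) : limn_einf u <= x%:E -> (0 < e)%R ->
  forall Q : set nat, (\forall n \near \oo, Q n) -> exists2 n, Q n & u n < (x + e)%:E.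
Proof.
move=> ux e0 Q Qoo; apply: contrapT => Qu.
have : limn_esup (\- u) <= - (x + e)%:E.
  apply: limn_esup_le_near; apply: filterS Qoo => n Qn.
  by rewrite leeN2 leNgt; apply/negP => unx; apply: Qu; exists n.
rewrite leeNr => /le_trans/(_ ux); rewrite lee_fin.
by rewrite gerDl leNgt e0.
Qed.

(** The telescoped inequality is kept free of subtractions, since [r k] and [a k] may be
    infinite. *)
Lemma sum_cost_le (r a : nat -> \bar R) (theta : R) n :
  (forall k, theta%:E + a k <= r k + a k.+1) ->
  (n%:R * theta)%:E + a 0%N <= \sum_(0 <= k < n) r k + a n.
Proof.
move=> ra; elim: n => [|n IH]; first by rewrite mul0r big_geq.
rewrite -natr1 mulrDl mul1r EFinD addeAC -addeA.
apply: (@le_trans _ _ (\sum_(0 <= k < n) r k + a n + theta%:E)).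
  by rewrite addeA; exact: leeD.
by rewrite -addeA [a n + _]addeC big_nat_recr//= -addeA leeD.
Qed.

Lemma avg_cost_ge (r a : nat -> \bar R) (theta c : R) :
  (forall k, 0 <= r k) -> c%:E <= a 0%N ->
  (forall k, theta%:E + a k <= r k + a k.+1) ->
  let avg := limn_esup (fun K : nat =>
    (K%:R^-1)%:E * \sum_(0 <= k < K.+1) r k) in
  (avg < +oo -> limn_einf (fun K : nat => (K%:R^-1)%:E * a K) <= 0) ->
  theta%:E <= avg.
Proof.
move=> r0 a0 ra avg trans; rewrite leNgt; apply/negP => avgth.
have [b /andP[avgb bth]] : exists b : R, (avg < b%:E) && (b < theta)%R.
  move: avgth; case: avg {trans} => [x|//|_].
    rewrite lte_fin => xth; exists ((x + theta) / 2)%R.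
    by rewrite lte_fin midf_lt// midf_lt.
  by exists (theta - 1)%R; rewrite ltNyr ltrBlDr ltrDl ltr01.
have {}trans := trans (lt_trans avgb (ltry _)).
(* Half of the gap between [b] and [theta]. Costs below K b together with a K < K e give K theta + c
   < K b + K e, that is K e < - c, which is impossible once K >= - c / e. *)
pose e := ((theta - b) / 2)%R.
have e0 : (0 < e)%R by rewrite divr_gt0// subr_gt0.
have near : \forall K \near \oo, [/\ (0 < K)%N, (- c / e <= K%:R)%R &
    (K%:R^-1)%:E * \sum_(0 <= k < K.+1) r k < b%:E].
  near=> K; split.
  - by near: K; exact: nbhs_infty_gt.
  - by near: K; exact: nbhs_infty_ger.
  - by near: K; exact: limn_esup_lt_near.
have [K [K0 Kc Kb] Ke] := limn_einf_le_near trans e0 near.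
have KR : (0 < K%:R :> R)%R by rewrite ltr0n.
move: Kb Ke; rewrite !lte_pdivrMl// add0r -!EFinM => Kb Ke.
have : (K%:R * theta)%:E + c%:E < (K%:R * b)%:E + (K%:R * e)%:E.
  apply: (@le_lt_trans _ _ ((K%:R * theta)%:E + a 0%N)); first by rewrite leeD2l.
  apply: (le_lt_trans (sum_cost_le K ra)).
  apply: lteD => //; apply: le_lt_trans Kb.
  (* The average cost has one stage more than the telescoped sum; that stage has nonnegative
     cost. *)
  by rewrite big_nat_recr//= leeDl.
rewrite -!EFinD lte_fin; apply/negP; rewrite -leNgt.
move: Kc; rewrite ler_pdivrMr// => Kc.
rewrite -mulrDr; have -> : (b + e = theta - e)%R by rewrite /e; field.
by rewrite mulrBr lerD2l lerNl.
Unshelve. all: by end_near. Qed.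

Lemma avg_cost_le (r a : nat -> \bar R) (theta c : R) :
  (forall k, c%:E <= a k) -> a 0%N < +oo ->
  (forall k, r k + a k.+1 = theta%:E + a k) ->
  limn_esup (fun K : nat => (K%:R^-1)%:E * \sum_(0 <= k < K.+1) r k) <= theta%:E.
Proof.
move=> ca a0 ra.
have a0fin : a 0%N \is a fin_num.
  by rewrite fin_numElt a0 andbT (lt_le_trans _ (ca 0%N))// ltNyr.
have sumE n : \sum_(0 <= k < n) r k + a n = (n%:R * theta)%:E + a 0%N.
  elim: n => [|n IH]; first by rewrite mul0r big_geq.
  rewrite big_nat_recr//= -addeA ra addeCA IH.
  by rewrite -natr1 mulrDl mul1r EFinD addeA [theta%:E + _]addeC.
apply/lee_addgt0Pr => e e0; rewrite -EFinD.
apply: limn_esup_le_near; near=> K.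
have K0 : (0 < K%:R :> R)%R by rewrite ltr0n; near: K; exact: nbhs_infty_gt.
rewrite lee_pdivrMl// -EFinM.
(* Telescoping over all K + 1 stages and bounding the final value below by [c] leaves an excess
   (theta + a 0 - c) / K over [theta] after division, which is below [e] for large K. *)
apply: (@le_trans _ _ ((K.+1%:R * theta)%:E + a 0%N - c%:E)).
  by rewrite leeBrDr// -sumE leeD.
rewrite -(fineK a0fin) -!EFinD lee_fin -natr1 mulrDl mul1r mulrDr.
rewrite -!addrA lerD2l -ler_pdivrMr//.
by near: K; exact: nbhs_infty_ger.
Unshelve. all: by end_near. Qed.

End average_cost_limits.

(** * Bellman equations *)

Lemma qform_ge0 (R : realType) n (Q : 'M[R]_n) x : posdefmx Q -> (0 <= qform Q x)%R.
Proof.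
move=> [_ Q0]; have [->|/Q0/ltW//] := eqVneq x 0%R.
by rewrite /qform mulmx0 mxE.
Qed.

Section bellman.
Context d (T : measurableType d) (R : realType) (P : probability T R).
Variables (S Nr Nt : nat) (p : plant R S Nr Nt) (N : randomness P S Nr Nt).
Hypotheses (Q0 : posdefmx (costQ p)) (R0 : posdefmx (costR p)).
Hypotheses (M0 : posdefmx (costM p)) (SA : standing_assumptions p N).

Local Notation state := (ext_state R S Nr Nt).
Local Notation action := ('cV[R]_Nt).

Lemma stage_cost_ge0 s u : 0 <= stage_cost p N s u.
Proof.
apply: adde_ge0; first by rewrite lee_fin addr_ge0 ?qform_ge0.
by apply: expectation_ge0 => t; exact: qform_ge0.
Qed.

Lemma measurable_stage_cost :
  measurable_fun [set: state * action] (fun z => stage_cost p N z.1 z.2).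
Proof.
have m1 : measurable_fun [set: state * action] (fun z => z.1.1.1).
  by apply: measurableT_comp => //; exact: measurableT_comp.
apply: emeasurable_funD.
  apply/measurable_EFinP; apply: measurable_funD.
    exact: measurable_fun_qform.
  exact: measurable_fun_qform.
rewrite unlock.
pose f (z : (state * action) * T) : \bar R :=
  (qform (costM p) (received z.1.1 z.1.2 (rxnoise N 0%N z.2)))%:E.
apply: (measurable_fun_lb_integral P (f := f) (a := 0%R)); last first.
  by move=> z; rewrite lee_fin qform_ge0.
apply/measurable_EFinP; apply: measurable_fun_qform; apply: measurable_fun_addmx.
  have ms : measurable_fun [set: (state * action) * T] (fun z => z.1.1).
    exact: measurableT_comp.
  have ms1 : measurable_fun [set: (state * action) * T] (fun z => z.1.1.1).
    exact: measurableT_comp.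
  apply: measurable_fun_scalemx.
    apply: (measurableT_comp (f := fun b : bool => b%:R : R)) => //.
    exact: measurableT_comp.
  apply: measurable_fun_mulmx; first exact: measurableT_comp.
  exact: measurableT_comp.
exact: measurableT_comp.
Qed.

Section bounded_below_value.
Variables (V : state -> R) (c : R).
Hypotheses (mV : measurable_fun [set: state] V) (cV : forall s, (c <= V s)%R).

Let next (z : (state * action) * (('cV[R]_Nr * 'cV[R]_S) * ('M[R]_(Nr, Nt) * bool))) :
    \bar R :=
  (V (step p z.1.1 z.1.2 z.2.1.1 z.2.1.2, z.2.2.1, z.2.2.2))%:E.

Let mnext : measurable_fun [set: _] next.
Proof.
apply/measurable_EFinP; apply: measurableT_comp mV _.
apply: measurable_fun_pair; first apply: measurable_fun_pair.
- apply: measurable_step.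
  + exact: measurableT_comp.
  + exact: measurableT_comp.
  + by apply: measurableT_comp => //; exact: measurableT_comp.
  + by apply: measurableT_comp => //; exact: measurableT_comp.
- by apply: measurableT_comp => //; exact: measurableT_comp.
- by apply: measurableT_comp => //; exact: measurableT_comp.
Qed.

Let next_ge z : c%:E <= next z. Proof. by rewrite lee_fin. Qed.

(** The second summand of [bellman_rhs], uncurried so that joint measurability in state and action
    can be stated. *)
Definition future (z : state * action) : \bar R :=
  'E_P[fun w => V (step p z.1 z.2 (rxnoise N 0%N w) (plnoise N 0%N w),
                   chan N 1%N w, active N 1%N w)].

Lemma futureE z : future z = \int[P]_w next (z, transition_noise N 0 w).
Proof. by rewrite /future unlock. Qed.

Let mtrans k : measurable_fun [set: T] (transition_noise N k).
Proof. by apply: depends_on_measurable; exact: depends_on_transition_noise. Qed.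

Lemma measurable_future : measurable_fun [set: state * action] future.
Proof.
rewrite (_ : future = fun z => \int[P]_w next (z, transition_noise N 0 w)); last first.
  by apply/funext => z; exact: futureE.
apply: (measurable_fun_lb_integral P (a := c)
  (f := fun y => next (y.1, transition_noise N 0 y.2))) => //.
by apply: (measurableT_comp mnext); apply: measurable_fun_pair => //; exact: measurableT_comp.
Qed.

Lemma future_ge z : c%:E <= future z.
Proof.
rewrite futureE; apply: lb_integral_ge => //.
by apply: (measurableT_comp mnext); exact: measurable_fun_pair.
Qed.

Lemma measurable_bellman_rhs (pi : state -> action) : measurable_fun [set: state] pi ->
  measurable_fun [set: state] (fun s => bellman_rhs p N V s (pi s)).
Proof.
move=> mpi; have mz : measurable_fun [set: state] (fun s => (s, pi s)).
  exact: measurable_fun_pair.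
apply: emeasurable_funD.
- exact: measurableT_comp measurable_stage_cost mz.
- exact: measurableT_comp measurable_future mz.
Qed.

Lemma bellman_rhs_ge s u : c%:E <= bellman_rhs p N V s u.
Proof.
by rewrite -[leLHS]add0e; apply: leeD; [exact: stage_cost_ge0|exact: (future_ge (s, u))].
Qed.

Section policy.
Variable pi : nat -> state -> action.
Hypothesis mpi : is_policy pi.

Let S_ k := sproc p N pi k.

Lemma measurable_sproc k : measurable_fun [set: T] (S_ k).
Proof.
by apply: (depends_on_measurable (N := N) (J := setT)); exact: depends_on_sproc.
Qed.

Let mSu k : measurable_fun [set: T] (fun w => (S_ k w, pi k (S_ k w))).
Proof.
apply: measurable_fun_pair; first exact: measurable_sproc.
exact: measurableT_comp (mpi k) (measurable_sproc k).
Qed.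

(** The tower property: S_k and u_k depend on sources disjoint from those of the transition noise of
    time k, and that noise has the law of the noise of time 0 used in [future]. *)
Lemma expectation_future k :
  \int[P]_w future (S_ k w, pi k (S_ k w)) = 'E_P[V \o S_ k.+1].
Proof.
pose J : set (source Nr Nt) := past_sources k `|` channel_sources k.
have SY : product_law P (fun w => (S_ k w, pi k (S_ k w)))
    (fun w => (S_ k w, pi k (S_ k w))) (transition_noise N k) (transition_noise N 0).
  apply: (depends_on_indep SA (J1 := J)
    (J2 := noise_sources k `|` channel_sources k.+1)).
  (* Past sources have time below k and current channel sources have time k, whereas the transition
     uses noises of time k and channels of time k + 1. *)
  - case=> [|j i l|j|j i|j] [|]//= jk [|]//= jk'; move: jk; rewrite ?jk' ?ltnn//.
    + by rewrite ltnNge leqnSn.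
    + by move/eqP; rewrite gtn_eqF.
    + by rewrite ltnNge leqnSn.
    + by move/eqP; rewrite gtn_eqF.
  - have dS : depends_on N J (S_ k) by apply: depends_on_sproc => // s; [left|right].
    by apply: measurable_fun_pair => //; exact: measurableT_comp (mpi k) dS.
  - exact: depends_on_transition_noise.
  - exact: (same_law_transition_noise SA).
have := integral_product_law (mSu k) (mSu k) (mtrans k) (mtrans 0) SY mnext next_ge.
rewrite unlock => ->.
by apply: eq_integral => w _; exact: futureE.
Qed.

Lemma expectation_bellman_rhs k :
  \int[P]_w bellman_rhs p N V (S_ k w) (pi k (S_ k w)) =
  \int[P]_w stage_cost p N (S_ k w) (pi k (S_ k w)) + 'E_P[V \o S_ k.+1].
Proof.
rewrite -expectation_future.
apply: (@lb_integralD _ _ _ P (fun w => stage_cost p N (S_ k w) (pi k (S_ k w)))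
  (fun w => future (S_ k w, pi k (S_ k w))) 0%R c).
- exact: measurableT_comp measurable_stage_cost (mSu k).
- exact: measurableT_comp measurable_future (mSu k).
- by move=> w; exact: stage_cost_ge0.
- by move=> w; exact: future_ge.
Qed.

Let mVS k : measurable_fun [set: T] (fun w => (V (S_ k w))%:E).
Proof. by apply/measurable_EFinP; exact: measurableT_comp mV (measurable_sproc k). Qed.

Lemma expectation_value_ge k : c%:E <= 'E_P[V \o S_ k].
Proof. by rewrite unlock; apply: (lb_integral_ge P (mVS k)) => w; rewrite lee_fin. Qed.

Lemma expectation_valueD k (a : R) :
  \int[P]_w (a + V (S_ k w))%:E = a%:E + 'E_P[V \o S_ k].
Proof.
rewrite unlock addeC -(lb_integralDr P (a := c) _ (mVS k)); last first.
  by move=> w; rewrite lee_fin.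
by apply: eq_integral => w _; rewrite /= addrC.
Qed.

Let mrhs k : measurable_fun [set: T] (fun w => bellman_rhs p N V (S_ k w) (pi k (S_ k w))).
Proof. exact: measurableT_comp (measurable_bellman_rhs (mpi k)) (measurable_sproc k). Qed.

Lemma bellman_avg_cost_ge (theta : R) :
  (forall s u, (theta + V s)%:E <= bellman_rhs p N V s u) ->
  (avg_cost p N pi < +oo ->
    limn_einf (fun K : nat => (K%:R^-1)%:E * 'E_P[V \o S_ K]) <= 0) ->
  theta%:E <= avg_cost p N pi.
Proof.
move=> thV; apply: (avg_cost_ge (c := c)).
- by move=> k; apply: integral_ge0 => w _; exact: stage_cost_ge0.
- exact: expectation_value_ge.
- move=> k; rewrite -expectation_bellman_rhs -expectation_valueD.
  apply: lb_le_integral => //.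
  apply/measurable_EFinP; apply: measurable_funD => //.
  exact: measurableT_comp mV (measurable_sproc k).
Qed.

Lemma bellman_avg_cost_le (theta : R) :
  (forall k s, (theta + V s)%:E = bellman_rhs p N V s (pi k s)) ->
  'E_P[V \o S_ 0] < +oo -> avg_cost p N pi <= theta%:E.
Proof.
move=> thV V0; apply: (avg_cost_le (c := c) (a := fun k => 'E_P[V \o S_ k])) => //.
- by move=> k; exact: expectation_value_ge.
- move=> k; rewrite -expectation_bellman_rhs -expectation_valueD.
  by apply: eq_integral => w _; exact/esym/thV.
Qed.

End policy.

(** [X] is independent of the channel of time k, whose law is that of time 0, so the channel can be
    averaged out first with [X] frozen. *)
Lemma expectation_channel k (J : set (source Nr Nt)) (X : T -> 'cV[R]_S) :
  depends_on N J X -> (forall s, J s -> channel_sources k s -> False) ->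
  'E_P[fun w => V (X w, chan N k w, active N k w)] =
  \int[P]_w mean_value N V 0 (X w).
Proof.
move=> JX Jk; have mX := depends_on_measurable JX.
have mchan j : measurable_fun [set: T] (fun t => (chan N j t, active N j t)).
  exact: measurable_fun_pair.
have XY := depends_on_indep SA Jk JX (depends_on_channel (@subset_refl _ _))
  (same_law_channel SA k 0).
pose f (z : 'cV[R]_S * ('M[R]_(Nr, Nt) * bool)) : \bar R := (V (z.1, z.2.1, z.2.2))%:E.
have mf : measurable_fun [set: _] f.
  apply/measurable_EFinP; apply: measurableT_comp mV _.
  apply: measurable_fun_pair; first apply: measurable_fun_pair => //.
    exact: measurableT_comp.
  exact: measurableT_comp.
have f_ge z : c%:E <= f z by rewrite lee_fin.
have := integral_product_law mX mX (mchan k) (mchan 0%N) XY mf f_ge.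
by rewrite /mean_value unlock.
Qed.

(** A constant depends on the empty set of sources, so this is [expectation_channel] at a constant
    state. *)
Lemma mean_valueE k x : mean_value N V k x = mean_value N V 0 x.
Proof.
rewrite {1}/mean_value (@expectation_channel k set0 (cst x))//.
  by rewrite -[RHS]mule1 -[X in _ * X](probability_setT P) -(integral_cst P measurableT).
exact: measurable_cst.
Qed.

End bounded_below_value.

(** Stated for an arbitrary solution because it is applied both to the constructed value function
    and to a competing pair, which yields uniqueness of [theta]. *)
Lemma admissible_bellman_theta (V : state -> R) (theta : R) :
  extended_bellman p N theta V -> admissible_value p N V ->
  (forall pi, is_policy pi -> theta%:E <= avg_cost p N pi) /\
  (forall pi, is_policy pi ->
    (forall k s, attains_min p N V s (pi k s)) -> avg_cost p N pi = theta%:E).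
Proof.
move=> [g mg gmin] [mV [c cV] V0 trans].
have lb pi : is_policy pi -> theta%:E <= avg_cost p N pi.
  move=> mpi; apply: (bellman_avg_cost_ge mV cV mpi) => [s u|]; last exact: trans.
  by have [smin ->] := gmin s; exact: smin.
split=> // pi mpi pimin; apply/eqP; rewrite eq_le lb// andbT.
apply: (bellman_avg_cost_le mV cV mpi) => // k s.
have [smin ->] := gmin s.
by apply/eqP; rewrite eq_le smin pimin.
Qed.

End bellman.

(** * From the reduced equation to the extended one *)

Theorem theorem2 (d : measure_display) (T : measurableType d) (R : realType)
    (P : probability T R) (S Nr Nt : nat)
    (p : plant R S Nr Nt) (N : randomness P S Nr Nt)
    (theta : R) (Vr : 'cV[R]_S -> R) :
  posdefmx (costQ p) -> posdefmx (costR p) -> posdefmx (costM p) ->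
  standing_assumptions p N ->
  reduced_bellman p N theta Vr ->
  admissible_value p N (lift_value Vr) ->
  exists V : ext_state R S Nr Nt -> R,
    [/\ extended_bellman p N theta V /\ admissible_value p N V,
        (forall (theta' : R) (V' : ext_state R S Nr Nt -> R),
           extended_bellman p N theta' V' -> admissible_value p N V' ->
           theta' = theta),
        (exists2 pi, is_policy pi & avg_cost p N pi = theta%:E) /\
        (forall pi, is_policy pi -> theta%:E <= avg_cost p N pi),
        (forall (k : nat) (x : 'cV[R]_S), (Vr x)%:E = mean_value N V k x) &
        forall pi : nat -> ext_state R S Nr Nt -> 'cV[R]_Nt,
          is_policy pi ->
          (forall k s, attains_min p N (lift_value Vr) s (pi k s)) ->
          optimal_policy p N pi].
Proof.
move=> Q0 R0 M0 SA [m [g mg gmin] mE] [mL [c cL] L0 transL].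
pose V s := (m s - theta)%R.
(* Measurability and the lower bound of [m] are read off from its equality with [bellman_rhs] along
   the measurable minimizer [g]. *)
have mm : measurable_fun [set: ext_state R S Nr Nt] m.
  apply/measurable_EFinP.
  rewrite (_ : EFin \o m = fun s => bellman_rhs p N (lift_value Vr) s (g s)).
    exact: (measurable_bellman_rhs N M0 mL cL mg).
  by apply/funext => s; exact: (gmin s).2.
have cm s : (c <= m s)%R.
  by rewrite -lee_fin (gmin s).2; exact: (bellman_rhs_ge N Q0 R0 M0 mL cL).
have mV : measurable_fun [set: ext_state R S Nr Nt] V by exact: measurable_funB.
have cV s : (c - theta <= V s)%R by rewrite lerB.
have VrE k x : (Vr x)%:E = mean_value N V k x.
  rewrite (mean_valueE SA mV cV); have := mE x.
  rewrite /mean_value unlock => {}mE.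
  rewrite (_ : (fun w => _) = fun w =>
    ((m (x, chan N 0 w, active N 0 w))%:E + (- theta)%:E)); last first.
    by apply/funext => w; rewrite EFinB.
  rewrite (lb_integralDr P (a := c)).
  - by rewrite -mE -EFinD addrAC subrr add0r.
  - apply/measurable_EFinP; apply: measurableT_comp mm _.
    by apply: measurable_fun_pair => //; exact: measurable_fun_pair.
  - by move=> w; rewrite lee_fin.
(* Averaging out a channel independent of [X] turns [V] into [Vr]. This is needed twice: for the
   continuation value, with the channel of time 1, and along the process at each time. *)
have liftE k J (X : T -> 'cV[R]_S) : depends_on N J X ->
    (forall s, J s -> channel_sources k s -> False) ->
    'E_P[fun w => V (X w, chan N k w, active N k w)] = 'E_P[fun w => Vr (X w)].
  move=> dX Jk; rewrite (expectation_channel SA mV cV dX Jk) unlock.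
  by apply: eq_integral => w _; rewrite -VrE.
have rhsE s u : bellman_rhs p N V s u = bellman_rhs p N (lift_value Vr) s u.
  (* With [s] and [u] frozen, the next plant state depends only on the noises of time 0. *)
  congr (_ + _); apply: (liftE 1%N (noise_sources 0)) => [|t].
    apply: (measurable_step p (s := cst s) (u := cst u)) => //.
    + by apply: depends_on_rxnoise.
    + by apply: depends_on_plnoise.
  by case: t.
have minE s u : attains_min p N V s u <-> attains_min p N (lift_value Vr) s u.
  by split=> us u'; have := us u'; rewrite !rhsE.
have sprocE pi k : is_policy pi ->
    'E_P[V \o sproc p N pi k] = 'E_P[lift_value Vr \o sproc p N pi k].
  move=> mpi; apply: (liftE k (past_sources k)).
    by apply: depends_on_xproc.
  by case=> [|j i l|j|j i|j]//= jk kj; move: jk; rewrite kj ltnn.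
have bellV : extended_bellman p N theta V.
  exists g => // s; split; first exact/minE/(gmin s).1.
  by rewrite /V addrC subrK rhsE; exact: (gmin s).2.
have admV : admissible_value p N V.
  split => //.
  - by exists (c - theta)%R.
  (* The state at time 0 is the same under every policy; the constant policy [g] is merely one at
     hand. *)
  - have := sprocE (fun=> g) 0%N (fun=> mg).
    by rewrite /sproc /= /comp /= => ->.
  - move=> pi mpi /(transL pi mpi).
    by under eq_fun do rewrite -sprocE//.
have [lb opt] := admissible_bellman_theta Q0 R0 M0 SA bellV admV.
have gpol : is_policy (fun=> g) by move=> k.
have gopt : avg_cost p N (fun=> g) = theta%:E.
  by apply: opt => // k s; exact/minE/(gmin s).1.
exists V; split; [exact: conj bellV admV| | |exact: VrE|].
- move=> theta' V' bellV' admV'.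
  have [lb' opt'] := admissible_bellman_theta Q0 R0 M0 SA bellV' admV'.
  have [g' mg' g'min] := bellV'.
  (* Each constant is a lower bound for all costs and is the cost of its own minimizer: [theta'] is
     at most the cost of [g], which is [theta], and [theta] is at most the cost of [g'], which is
     [theta']. *)
  apply/eqP; rewrite eq_le -!lee_fin -[X in _ <= X]gopt lb'//=.
  rewrite -(opt' (fun=> g')) => [|//|k s]; last exact: (g'min s).1.
  exact: lb.
- by split=> //; exists (fun=> g).
- move=> pi mpi pimin; split=> [|pi' mpi']; first exact: mpi.
  rewrite (opt pi mpi) => [|k s]; first exact: lb mpi'.
  exact/minE/pimin.
Qed.
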